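(* Let $M$ be a smooth manifold, $r\ge 0$ an integer, $(\tau,\omega)$ a doublet of class $2r+2$ on $M$ with $\tau\in\Omega^1(M)$ nowhere-vanishing and $\omega\in\Omega^2(M)$, and let $f\in C^\infty(M)$. Then $(e^f\tau,\ e^f(df\wedge\tau+\omega))$ is a doublet of class $2r+1$ if, and only if, for all Liouville vector fields $\Delta$ of $(\tau,\omega)$ we have $$\mathscr L_\Delta f=-1.$$
   Context: The class of a pair $(\tau,\omega)$ of a 1-form and a 2-form at $x\in M$ is the codimension in $T_xM$ of $\operatorname{Ker}\tau_x\cap\operatorname{Ker}\omega_x$, where $\operatorname{Ker}\alpha_x=\{v\in T_xM\mid\iota_v\alpha_x=0\}$. A doublet is a pair whose class is constant on $M$. A Liouville vector field of $(\tau,\omega)$ is a vector field $\Delta$ on $M$ with $\iota_\Delta\omega=\tau$. $\mathscr L$ denotes the Lie derivative. *)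

(* Defs.v *)
From HB Require Import structures.
From mathcomp Require Import all_boot all_order all_algebra.
From mathcomp Require Import all_classical all_reals all_analysis.

Set Implicit Arguments.
Unset Strict Implicit.
Unset Printing Implicit Defensive.

Import Order.TTheory GRing.Theory Num.Theory.
Import numFieldNormedType.Exports.

Local Open Scope classical_set_scope.
Local Open Scope ring_scope.

(* C^k on an open set U; g may take arbitrary values outside U. *)
Fixpoint Ck (R : realType) (V W : normedModType R) (k : nat)
    (U : set V) (g : V -> W) : Prop :=
  if k is k'.+1 then
    (forall x, U x -> differentiable g x) /\
    (forall v, Ck k' U (fun x => 'd g x v))
  else forall x, U x -> {for x, continuous g}.

Definition smooth_on (R : realType) (V W : normedModType R)
    (U : set V) (g : V -> W) : Prop :=
  forall k, Ck k U g.

(* A homeomorphism from an open subset of M onto an open subset of R^n. Both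
   directions are total functions, only meaningful on [dom] and on its image. *)
Record chart (R : realType) (n : nat) (M : topologicalType) := Chart {
  chart_fun :> M -> 'rV[R]_n ;
  chart_inv : 'rV[R]_n -> M ;
  dom : set M ;
  open_dom : open dom ;
  open_codom : open (chart_fun @` dom) ;
  chart_funK : forall x, dom x -> chart_inv (chart_fun x) = x ;
  chart_continuous : forall x, dom x -> {for x, continuous chart_fun} ;
  chart_inv_continuous :
    forall y, (chart_fun @` dom) y -> {for y, continuous chart_inv} }.

Definition codom_chart (R : realType) (n : nat) (M : topologicalType)
    (c : chart R n M) : set 'rV[R]_n := c @` dom c.

(* The atlas need not be maximal. *)
Record manifold (R : realType) (n : nat) := Manifold {
  points :> topologicalType ;
  atlas : set (chart R n points) ;
  manifold_hausdorff : hausdorff_space points ;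
  manifold_second_countable : @second_countable points ;
  atlas_cover : forall x : points, exists2 c, atlas c & dom c x ;
  atlas_compatible : forall c d, atlas c -> atlas d ->
    smooth_on (c @` (dom c `&` dom d)) (d \o chart_inv c) }.

Definition chart_at (R : realType) (n : nat) (M : manifold R n) (x : M) :
    chart R n M :=
  projT1 (cid2 (atlas_cover x)).

(* A tangent vector at x is represented by its components in the fixed chart
   [chart_at x]; [components] and [coord_vector] below translate from and to
   the other charts around x by the differential of the transition map. *)
Definition tangent (R : realType) (n : nat) (M : manifold R n) (x : M) :
    vectType R :=
  'rV[R]_n.

(* The components in the chart c, with x in [dom c], of a vector of T_x M. *)
Definition components (R : realType) (n : nat) (M : manifold R n)
    (c : chart R n M) (x : M) (v : tangent x) : 'rV[R]_n :=
  'd (c \o chart_inv (chart_at x)) (chart_at x x) v.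

(* The vector of T_x M with components e in the chart c, with x in [dom c]. *)
Definition coord_vector (R : realType) (n : nat) (M : manifold R n)
    (c : chart R n M) (x : M) (e : 'rV[R]_n) : tangent x :=
  'd (chart_at x \o chart_inv c) (c x) e.

Definition vfield (R : realType) (n : nat) (M : manifold R n) : Type :=
  forall x : M, tangent x.

Definition covfield (R : realType) (n : nat) (M : manifold R n) : Type :=
  forall x : M, 'Hom(tangent x, R^o).

(* Curried bilinear forms: [omega x v] is the contraction of [omega x] by v,
   so that [lker (omega x)] is the kernel of [omega x]. *)
Definition bilfield (R : realType) (n : nat) (M : manifold R n) : Type :=
  forall x : M, 'Hom(tangent x, 'Hom(tangent x, R^o)).

Definition smooth_fun (R : realType) (n : nat) (M : manifold R n)
    (f : M -> R) : Prop :=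
  forall c : chart R n M, atlas c ->
    smooth_on (codom_chart c) (f \o chart_inv c : 'rV[R]_n -> R^o).

Definition smooth_vfield (R : realType) (n : nat) (M : manifold R n)
    (X : vfield M) : Prop :=
  forall c : chart R n M, atlas c ->
    smooth_on (codom_chart c)
      (fun y => components c (X (chart_inv c y))).

Definition is_form1 (R : realType) (n : nat) (M : manifold R n)
    (tau : covfield M) : Prop :=
  forall c : chart R n M, atlas c -> forall e : 'rV[R]_n,
    smooth_on (codom_chart c)
      (fun y => let x := chart_inv c y in tau x (coord_vector c x e)).

Definition is_form2 (R : realType) (n : nat) (M : manifold R n)
    (omega : bilfield M) : Prop :=
  (forall (x : M) (v : tangent x), omega x v v = 0) /\
  (forall c : chart R n M, atlas c -> forall e e' : 'rV[R]_n,
    smooth_on (codom_chart c)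
      (fun y => let x := chart_inv c y in
         omega x (coord_vector c x e) (coord_vector c x e'))).

Definition df (R : realType) (n : nat) (M : manifold R n) (f : M -> R) :
    covfield M :=
  fun x => linfun
    ('d (f \o chart_inv (chart_at x) : 'rV[R]_n -> R^o) (chart_at x x)).

(* No factor 1/2. *)
Definition wedge (R : realType) (V : vectType R) (a b : 'Hom(V, R^o)) :
    'Hom(V, 'Hom(V, R^o)) :=
  linfun (fun v => a v *: b - b v *: a).

Lemma wedgeE (R : realType) (V : vectType R) (a b : 'Hom(V, R^o)) (v w : V) :
  wedge a b v w = a v * b w - b v * a w.
Proof.
pose h v : 'Hom(V, R^o) := a v *: b - b v *: a.
have hl : linear h.
  move=> k x y; rewrite /h (linearP a) (linearP b) /= !scalerDl opprD addrACA.
  by rewrite scalerBr !scalerA.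
pose L := GRing.isLinear.Build R V 'Hom(V, R^o) _ h hl.
pose H : {linear V -> 'Hom(V, R^o)} := HB.pack h L.
have -> : wedge a b v = h v by rewrite /wedge (lfunE H).
by rewrite /h !lfunE /= lfunE /= opp_lfunE !scale_lfunE.
Qed.

(* On functions. *)
Definition lie_derivative (R : realType) (n : nat) (M : manifold R n)
    (X : vfield M) (f : M -> R) : M -> R :=
  fun x => df f x (X x).

Definition class_at (R : realType) (n : nat) (M : manifold R n)
    (tau : covfield M) (omega : bilfield M) (x : M) : nat :=
  (\dim (fullv : {vspace tangent x})
   - \dim (lker (tau x) :&: lker (omega x))%VS)%N.

Definition doublet_of_class (R : realType) (n : nat) (M : manifold R n)
    (k : nat) (tau : covfield M) (omega : bilfield M) : Prop :=
  [/\ is_form1 tau, is_form2 omega & forall x : M, class_at tau omega x = k].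

Definition liouville (R : realType) (n : nat) (M : manifold R n)
    (tau : covfield M) (omega : bilfield M) (X : vfield M) : Prop :=
  smooth_vfield X /\ forall x : M, omega x (X x) = tau x.

(* Main.v *)
From HB Require Import structures.
Require Import Defs.
From mathcomp Require Import all_boot all_order all_algebra.
From mathcomp Require Import all_classical all_reals all_analysis.
From mathcomp Require Import lra zify ring.

(** Everything is pointwise except one existence statement.

    Fix a point and write K for the kernel of omega there.  An alternating form
    has even rank, and intersecting K with the kernel of tau lowers its
    dimension by at most one; since the class 2r+2 is even, K is contained in
    the kernel of tau ([even_class_lker]), so the rank of omega is 2r+2 and tau
    lies in the image of omega ([alternating_image]).  Pick D with
    [omega D = tau].  The positive factors e^f do not change kernels, and v is
    in the common kernel K' of tau and df /\ tau + omega exactly when tau v = 0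
    and omega v = - df v * tau = omega (- df v * D); hence K' is contained in
    the direct sum of K and the line of D.  The new class is 2r+1 exactly when
    K' is the whole sum, and membership of D and of the elements D + k, for k
    in K, says that df takes the value -1 on every solution D of
    [omega D = tau] ([odd_class_iff]).

    This gives the direct implication at once.  For the converse, the
    hypothesis speaks of global smooth Liouville fields only, so every
    pointwise solution of [omega D = tau] must be shown to be the value of such
    a field ([exists_liouville]).  Near a point, in a chart, fix the
    coordinates of a basis of a complement of the kernel of omega: its Gram
    matrix stays invertible nearby, and, the rank being constant, Cramer's rule
    corrects a constant field into a smooth solution ([local_liouville]).
    Smooth cutoff functions, which come from exp (-1/t) and extend by zero
    because compact subsets of a Hausdorff space are closed
    ([exists_smooth_cutoff]), and a countable subcover ([lindelof]) glue the
    local solutions.  The weights are g_i * prod_(j < i) (1 - g_j), where g_i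
    is equal to 1 near the i-th point: near a given point all but finitely many
    of them vanish, whatever the cover, and the others add up to 1.

    Smoothness means that all iterated Frechet differentials exist; most of
    the calculus below is the stability of this notion under the operations
    that occur in these formulas. *)

Set Implicit Arguments.
Unset Strict Implicit.
Unset Printing Implicit Defensive.

Import Order.TTheory GRing.Theory Num.Theory.
Import numFieldNormedType.Exports.

Local Open Scope classical_set_scope.
Local Open Scope ring_scope.

(** * Alternating forms and classes of pairs *)

Section Alternating.
Variables (R : numFieldType) (V : vectType R).
Implicit Types (w : 'Hom(V, 'Hom(V, R^o))) (t : 'Hom(V, R^o)).

Definition alternating_form w := forall v, w v v = 0.

Lemma alternatingC w : alternating_form w -> forall u v, w u v = - w v u.
Proof.
move=> alt u v; have := alt (u + v).
rewrite [w (u + v)]linearD add_lfunE !linearD /= !alt add0r addr0.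
by move/eqP; rewrite addr_eq0 => /eqP.
Qed.

Definition gram w m (u : 'I_m -> V) : 'M[R]_m := \matrix_(i, j) w (u i) (u j).

Lemma gram_combination w m (u : 'I_m -> V) (c : 'rV[R]_m) j :
  w (\sum_i c 0 i *: u i) (u j) = (c *m gram w u) 0 j.
Proof.
rewrite linear_sum sum_lfunE mxE; apply: eq_bigr => i _.
by rewrite linearZ scale_lfunE mxE.
Qed.

(** The linear combination of the [u i] with prescribed pairings [c] against
    them; the explicit inverse makes the coefficients smooth when w, u and c
    vary smoothly. *)
Lemma gram_solve w m (u : 'I_m -> V) (c : 'rV[R]_m) j :
  gram w u \in unitmx ->
  w (\sum_i (c *m invmx (gram w u)) 0 i *: u i) (u j) = c 0 j.
Proof. by move=> Gu; rewrite gram_combination mulmxKV. Qed.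

(** On a complement of its kernel an alternating form is nondegenerate: a
    vector of the complement that pairs to zero with the complement pairs to
    zero with the kernel too, hence lies in both. *)
Lemma exists_gram_unit w : alternating_form w ->
  exists m (u : 'I_m -> V),
    (m + \dim (lker w) = \dim {:V})%N /\ gram w u \in unitmx.
Proof.
move=> alt; pose S := ((lker w)^C)%VS.
pose u (i : 'I_(\dim S)) := (vbasis S)`_i.
exists (\dim S), u; split.
  by rewrite /S dimv_compl subnK // dimvS // subvf.
rewrite -row_free_unit; apply: inj_row_free => c cG0.
have wu0 j : w (\sum_i c 0 i *: u i) (u j) = 0.
  by rewrite gram_combination cG0 mxE.
have uS i : u i \in S by rewrite vbasis_mem // mem_nth // size_tuple.
have vS : \sum_i c 0 i *: u i \in S.
  by apply: memv_suml => i _; apply: memvZ.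
have vK : \sum_i c 0 i *: u i \in lker w.
  rewrite memv_ker; apply/eqP/lfunP => x; rewrite zero_lfunE.
  have : x \in (lker w + S)%VS by rewrite /S addv_complf memvf.
  case/memv_addP => k kK [s sS ->]; rewrite linearD /=.
  move: kK; rewrite memv_ker => /eqP kK.
  rewrite (alternatingC alt) kK zero_lfunE oppr0 add0r.
  rewrite (coord_vbasis sS) linear_sum big1 // => i _.
  by rewrite linearZ /= -/(u i) wu0 scaler0.
have v0 : \sum_i c 0 i *: u i = 0.
  by apply/eqP; rewrite -memv0 -(capv_compl (lker w)) memv_cap vK.
have /freeP fr := basis_free (vbasisP S).
by apply/rowP => i; rewrite mxE; exact: (fr (fun i => c 0 i)).
Qed.

(** Invertibility of the Gram matrix makes the [u i] independent modulo the
    kernel of w, and the count of dimensions makes them span a complement of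
    it. *)
Lemma gram_separates w m (u : 'I_m -> V) t : alternating_form w ->
  (m + \dim (lker w) = \dim {:V})%N -> gram w u \in unitmx ->
  (lker w <= lker t)%VS -> (forall i, t (u i) = 0) -> t = 0.
Proof.
move=> alt dimm Gu wt tu.
have inj (c : 'rV[R]_m) : \sum_i c 0 i *: u i \in lker w -> c = 0.
  rewrite memv_ker => /eqP cK; apply: (can_inj (mulmxK Gu)).
  by apply/rowP => j; rewrite -gram_combination cK mul0mx mxE zero_lfunE.
pose X := [tuple u i | i < m].
have Xn (i : 'I_m) : X`_i = u i by rewrite -tnth_nth tnth_mktuple.
have Xfree : free X.
  apply/freeP => k k0 i.
  have /rowP/(_ i) : \row_i k i = 0.
    apply: inj; rewrite (_ : \sum_ _ _ = 0) ?mem0v // -[RHS]k0.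
    by apply: eq_bigr => j _; rewrite mxE Xn.
  by rewrite !mxE.
have cap0 : (<<X>> :&: lker w = 0)%VS.
  apply/eqP; rewrite -subv0; apply/subvP => v; rewrite memv_cap => /andP[vX vK].
  move: vK; rewrite (coord_span vX) => vK.
  have /inj c0 : \sum_i (\row_i coord X i v) 0 i *: u i \in lker w.
    by under eq_bigr do rewrite mxE -Xn.
  rewrite big1 ?mem0v // => i _.
  by have /rowP/(_ i) := c0; rewrite !mxE => ->; rewrite scale0r.
have full : (<<X>> + lker w = fullv)%VS.
  apply/eqP; rewrite eqEdim subvf /= dimv_disjoint_sum //.
  by rewrite (eqP Xfree) size_tuple dimm.
apply/lfunP => v; rewrite zero_lfunE.
have : v \in (<<X>> + lker w)%VS by rewrite full memvf.
case/memv_addP => s sX [k kK ->]; rewrite linearD /=.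
have /eqP-> : t k == 0 by rewrite -memv_ker (subvP wt).
rewrite addr0 (coord_span sX) linear_sum big1 // => i _.
by rewrite linearZ /= Xn tu scaler0.
Qed.

(** The Gram matrix on a complement of the kernel is invertible and
    skew-symmetric; taking determinants, an odd size would force the
    determinant to vanish. *)
Lemma alternating_rank_even w : alternating_form w ->
  ~~ odd (\dim {:V} - \dim (lker w)).
Proof.
move=> alt; have [m [u [<-]]] := exists_gram_unit alt.
rewrite addnK unitmxE unitfE => detG; apply/negP => m_odd.
have /(congr1 determinant) : (gram w u)^T = (-1) *: gram w u.
  by apply/matrixP => i j; rewrite !mxE (alternatingC alt) mulN1r.
rewrite det_tr detZ -signr_odd m_odd expr1 mulN1r => /eqP.
by rewrite -addr_eq0 -mulr2n mulrn_eq0 /= (negbTE detG).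
Qed.

(** The kernel of a covector cuts the kernel of w in dimension 0 or 1 less, and
    parity excludes the latter. *)
Lemma even_class_lker w t r : alternating_form w ->
  (\dim {:V} - \dim (lker t :&: lker w) = 2 * r + 2)%N ->
  (lker w <= lker t)%VS.
Proof.
move=> alt cls; have ev := alternating_rank_even alt.
have dK := limg_ker_dim t (lker w).
have d1 : (\dim (t @: lker w) <= 1)%N.
  by rewrite (leq_trans (dimvS (subvf _))) // dimvf /dim /=.
have dV : (\dim (lker w) <= \dim {:V})%N by rewrite dimvS ?subvf.
suff e : \dim (lker w :&: lker t) = \dim (lker w).
  by have /eqP <- : (lker w :&: lker t)%VS == lker w
    by [rewrite eqEdim capvSl e /=]; exact: capvSr.
move: cls; rewrite capvC; lia.
Qed.

(** The candidate has the right pairings with a complement of the kernel, and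
    both covectors vanish on the kernel. *)
Lemma alternating_image w t : alternating_form w -> (lker w <= lker t)%VS ->
  exists v, w v = t.
Proof.
move=> alt wt; have [m [u [dimm Gu]]] := exists_gram_unit alt.
exists (\sum_i ((\row_j t (u j)) *m invmx (gram w u)) 0 i *: u i).
apply/subr0_eq; apply: (gram_separates alt dimm Gu).
  apply/subvP => k kK; rewrite memv_ker add_lfunE opp_lfunE.
  have /eqP-> : t k == 0 by rewrite -memv_ker (subvP wt).
  move: kK; rewrite memv_ker => /eqP kK.
  by rewrite (alternatingC alt) kK zero_lfunE !oppr0 addr0.
by move=> j; rewrite add_lfunE opp_lfunE gram_solve // mxE subrr.
Qed.

End Alternating.

(** With [w D = t], the common kernel of the new pair lies in the direct sum of
    [lker w] and the line of D, whose dimension is one more than that of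
    [lker w]; the new class is [2 * r + 1] exactly when the two agree. *)
Lemma odd_class_iff (R : realType) (V : vectType R)
    (w : 'Hom(V, 'Hom(V, R^o))) (t a : 'Hom(V, R^o)) (s : R) (r : nat) :
  alternating_form w -> t <> 0 -> s != 0 ->
  (\dim {:V} - \dim (lker t :&: lker w) = 2 * r + 2)%N ->
  (\dim {:V} - \dim (lker (s *: t) :&: lker (s *: (wedge a t + w))) =
    2 * r + 1)%N <->
  (forall v, w v = t -> a v = -1).
Proof.
move=> alt t0 s0 cls.
have wt := even_class_lker alt cls.
have [D wD] := alternating_image alt wt.
set K' := (lker (s *: t) :&: _)%VS.
have memK' v : (v \in K') = (t v == 0) && (w v == - a v *: t).
  rewrite memv_cap !memv_ker !scale_lfunE !scaler_eq0 (negbTE s0) /=.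
  case: eqP => //= tv; rewrite add_lfunE addrC -[RHS]subr_eq0 scaleNr opprK.
  congr (_ + _ == 0); apply/lfunP => x.
  by rewrite wedgeE tv mul0r subr0 scale_lfunE.
have DK : D \notin lker w by rewrite memv_ker wD; apply/eqP.
have D0 : D != 0 by apply: contraNneq DK => ->; rewrite mem0v.
have tD : t D = 0 by rewrite -wD alt.
have K'sub : (K' <= lker w + <[D]>)%VS.
  apply/subvP => v; rewrite memK' => /andP[_ /eqP wv].
  apply/memv_addP; exists (v + a v *: D).
    by rewrite memv_ker linearD linearZ /= wv wD scaleNr addNr.
  exists (- a v *: D); first by rewrite memvZ // memv_line.
  by rewrite scaleNr addrK.
have dimKD : \dim (lker w + <[D]>)%VS = (\dim (lker w)).+1.
  rewrite dimv_disjoint_sum ?dim_vline ?D0 ?addn1 //.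
  apply/eqP; rewrite -subv0; apply/subvP => v; rewrite memv_cap => /andP[vK].
  case/vlineP => k vk; move: vK; rewrite vk rpredZeq (negbTE DK) orbF => /eqP ->.
  by rewrite scale0r mem0v.
have eK : (lker t :&: lker w)%VS = lker w by apply/capv_idPr.
rewrite eK in cls.
have -> : (\dim {:V} - \dim K' = 2 * r + 1)%N <-> K' = (lker w + <[D]>)%VS.
  split=> [e|->]; last by rewrite dimKD; lia.
  by apply/eqP; rewrite eqEdim K'sub dimKD; lia.
split=> [e v wv|h].
  have : v \in K'.
    rewrite e; apply/memv_addP; exists (v - D).
      by rewrite memv_ker linearB /= wv wD subrr.
    by exists D; rewrite ?memv_line ?subrK.
  rewrite memK' wv => /andP[_ /eqP]; rewrite -{1}[t]scale1r.
  move/eqP; rewrite -subr_eq0 -scalerBl scaler_eq0 subr_eq0.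
  by case: (t =P 0) => // _; rewrite orbF => /eqP ->; rewrite opprK.
apply/eqP; rewrite eqEsubv K'sub subv_add /=; apply/andP; split.
  apply/subvP => k kK; rewrite memK'.
  have -> : t k == 0 by rewrite -memv_ker (subvP wt).
  move: kK; rewrite memv_ker => /eqP wk; rewrite wk.
  have := h (D + k); rewrite !linearD /= wD wk addr0 => /(_ erefl)/eqP.
  by rewrite (h D wD) -subr_eq0 addrC addKr => /eqP ->; rewrite oppr0 scale0r eqxx.
by rewrite -memvE memK' tD eqxx wD h // opprK scale1r eqxx.
Qed.

(** * Stability of the classes C^k *)

(** The differential depends only on the germ; this is what lets local formulas
    be differentiated, since the functions involved are arbitrary outside an
    open set. *)
Lemma near_eq_is_diff (R : realType) (V W : normedModType R) (f g : V -> W) x :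
  (\near x, f x = g x) -> differentiable f x -> is_diff x g ('d f x).
Proof.
move=> fg df; have [dfc dfo] := (diff_locallyP _ _).1 df.
have gx : f x = g x by exact: (nbhs_singleton fg).
have go : g \o shift x = cst (g x) + 'd f x +o_ 0 id.
  apply/eqaddoP => e e0; move/eqaddoP: dfo => /(_ e e0).
  have : \forall h \near (0 : V), f (h + x) = g (h + x).
    by have := fg; rewrite (near_shift 0) /= subr0.
  by apply: filterS2 => h; rewrite !fctE /= gx => ->.
have dgE := diff_unique dfc go.
have gd : differentiable g x.
  by apply: (diff_locallyP _ _).2; rewrite dgE; split; [exact: dfc|exact: go].
by apply: DiffDef; [exact: gd|exact: dgE].
Qed.

Lemma row_sum_coord (R : realType) (V : normedModType R) n (h : V -> 'rV[R]_n) :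
  h = \sum_(i < n) (fun x => h x 0 i *: delta_mx 0 i).
Proof. by apply/funext => x; rewrite fct_sumE -row_sum_delta. Qed.

Lemma diff_coord (R : realType) (V : normedModType R) n (h : V -> 'rV[R]_n) i x v :
  differentiable h x -> 'd (fun x => h x 0 i : R^o) x v = 'd h x v 0 i.
Proof.
move=> hd; pose c (y : 'rV[R]_n) : R := y 0 i.
have cl : linear c by move=> a y z; rewrite /c !mxE.
pose L := GRing.isLinear.Build _ _ _ _ _ cl.
pose C : {linear 'rV[R]_n -> R} := HB.pack c L.
rewrite (@diff_comp _ _ _ _ h c) //; last exact: differentiable_coord.
by rewrite /= (@diff_lin _ _ _ C) //; exact: coord_continuous.
Qed.

Lemma diff_comp_row (R : realType) (V W : normedModType R) n (g : 'rV[R]_n -> W)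
    (h : V -> 'rV[R]_n) x v : differentiable h x -> differentiable g (h x) ->
  'd (g \o h) x v = \sum_(i < n) 'd h x v 0 i *: 'd g (h x) (delta_mx 0 i).
Proof.
move=> hd gd; rewrite (@diff_comp _ _ _ _ h g x hd gd) /comp.
rewrite [X in 'd g (h x) X]row_sum_delta linear_sum.
by apply: eq_bigr => i _; exact: linearZ.
Qed.

Section Ck_theory.
Variable R : realType.
Implicit Types V W : normedModType R.

(** [Ck] is a conjunction of conditions at the points of the set, which makes it
    local. *)
Lemma Ck_ptP V W k (U : set V) (g : V -> W) :
  Ck k U g <-> forall x, U x -> Ck k [set x] g.
Proof.
elim: k U g => [|k IH] U g /=.
  by split=> [h x Ux y ->|h x Ux]; [exact: (h x Ux) | exact: (h x Ux x)].
split=> [[h1 h2] x Ux|h].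
  split=> [y ->|v]; first exact: h1.
  exact: ((IH _ _).1 (h2 v) x Ux).
by split=> [x Ux|v]; [exact: (h x Ux).1 | apply/IH => x /h [_]; exact].
Qed.

Lemma Ck_sub V W k (U U' : set V) (g : V -> W) :
  U' `<=` U -> Ck k U g -> Ck k U' g.
Proof. by move=> sub /Ck_ptP h; apply/Ck_ptP => x /sub; exact: h. Qed.

(** Openness is needed: the differential at a point sees a whole neighbourhood
    of it. *)
Lemma Ck_eq V W k (U : set V) (f g : V -> W) : open U ->
  (forall x, U x -> f x = g x) -> Ck k U f -> Ck k U g.
Proof.
move=> oU; have nU x : U x -> nbhs x U by move=> Ux; exact: open_nbhs_nbhs.
elim: k f g => [|k IH] f g fg /=.
  move=> h x Ux; rewrite /prop_for /continuous_at -fg //.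
  apply: cvg_trans (h x Ux); apply: near_eq_cvg.
  by apply: filterS (nU x Ux) => z; exact: fg.
have dg x : U x -> differentiable f x -> is_diff x g ('d f x).
  move=> Ux; apply: near_eq_is_diff; apply: filterS (nU x Ux) => z; exact: fg.
case=> h1 h2; split=> [x Ux|v].
  by have [] := dg x Ux (h1 x Ux).
apply: IH (h2 v) => x Ux.
by have [_ ->] := dg x Ux (h1 x Ux).
Qed.

Lemma CkS V W k (U : set V) (g : V -> W) : Ck k.+1 U g -> Ck k U g.
Proof.
elim: k g => [|k IH] g; first by case=> h _ x /h /differentiable_continuous.
by case=> h1 h2; split=> // v; apply: IH.
Qed.

Lemma Ck_cst V W k (U : set V) (b : W) : Ck k U (cst b).
Proof.
elim: k b => [|k IH] b /=; first by move=> x _; exact: cvg_cst.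
split=> [x _|v]; first exact: differentiable_cst.
by rewrite [X in Ck _ _ X](_ : _ = cst 0) //; apply/funext => x; rewrite diff_cst.
Qed.

Section Open.
Variables (V W : normedModType R) (U : set V).
Hypothesis oU : open U.

Lemma CkD k (f g : V -> W) : Ck k U f -> Ck k U g -> Ck k U (f + g).
Proof.
elim: k f g => [|k IH] f g /=.
  by move=> hf hg x Ux; apply: cvgD; [exact: hf | exact: hg].
move=> [f1 f2] [g1 g2]; split=> [x Ux|v].
  by apply: differentiableD; [exact: f1 | exact: g1].
apply: Ck_eq (IH _ _ (f2 v) (g2 v)) => // x Ux.
by rewrite diffD //; [exact: f1 | exact: g1].
Qed.

End Open.

Section OpenScalar.
Variables (V : normedModType R) (U : set V).
Hypothesis oU : open U.

Lemma CkM k (f g : V -> R^o) : Ck k U f -> Ck k U g ->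
  Ck k U (fun x => f x * g x : R^o).
Proof.
elim: k f g => [|k IH] f g.
  by move=> hf hg x Ux; apply: (@cvgM _ _ _ _ f g); [exact: hf | exact: hg].
move=> hf hg; have [f1 f2] := hf; have [g1 g2] := hg.
split=> [x Ux|v].
  by apply: (@differentiableM _ _ f g); [exact: f1 | exact: g1].
apply: (@Ck_eq _ _ _ _ ((fun x => f x * 'd g x v : R^o) +
                 (fun x => g x * 'd f x v : R^o))) => //.
  by move=> x Ux; rewrite (diffM (f1 x Ux) (g1 x Ux)); reflexivity.
by apply: CkD => //; apply: IH; [exact: CkS|exact: g2|exact: CkS|exact: f2].
Qed.

(** A family of functions of one variable closed under differentiation consists
    of smooth functions.  Stating this for composites with a smooth function
    turns the chain rule into an induction on the order. *)
Lemma Ck_family (F : set (R -> R)) (D : set R) :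
  (forall p, F p -> exists2 p', F p' & forall t, D t -> is_derive t 1 p (p' t)) ->
  forall k (p : R -> R) (a : V -> R^o), F p -> (forall x, U x -> D (a x)) ->
    Ck k U a -> Ck k U (fun x => p (a x) : R^o).
Proof.
move=> FD; elim=> [|k IH] p a Fp aD.
  have [p' _ dp] := FD p Fp.
  move=> ha x Ux; apply: (@continuous_comp _ _ _ a p); first exact: ha.
  have [der _] := dp _ (aD x Ux).
  by apply/differentiable_continuous/derivable1_diffP.
have [p' Fp' dp] := FD p Fp.
move=> ha; have [a1 a2] := ha.
have pd x : U x -> differentiable p (a x).
  by move=> Ux; have [der _] := dp _ (aD x Ux); apply/derivable1_diffP.
split=> [x Ux|v].
  by apply: (@differentiable_comp _ _ _ _ a p); [exact: a1 | exact: pd].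
apply: (@Ck_eq _ _ _ _ (fun x => 'd a x v * p' (a x) : R^o)) => //.
  move=> x Ux; have [der <-] := dp _ (aD x Ux).
  have E := @diff_comp R V R^o R^o a p x (a1 x Ux) (pd x Ux).
  have /= Ev := congr1 (@^~ v) E.
  by rewrite [RHS]Ev (deriv1E der) derive1E.
by apply: CkM => //; [exact: a2|apply: IH => //; exact: CkS].
Qed.

Lemma Ck_coord n k (h : V -> 'rV[R]_n) i :
  Ck k U h -> Ck k U (fun x => h x 0 i : R^o).
Proof.
elim: k h => [|k IH] h.
  move=> hh x Ux; apply: (@continuous_comp _ _ _ h (fun y : 'rV_n => y 0 i)).
    exact: hh.
  exact: coord_continuous.
move=> [h1 h2]; split=> [x Ux|v].
  apply: (@differentiable_comp _ _ _ _ h (fun y : 'rV_n => y 0 i)).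
    exact: h1.
  exact: differentiable_coord.
by apply: Ck_eq (IH _ (h2 v)) => // x Ux; rewrite diff_coord //; exact: h1.
Qed.

Lemma Ck_coords n k (h : V -> 'rV[R]_n) :
  (forall i, Ck k U (fun x => h x 0 i : R^o)) -> Ck k U h.
Proof.
elim: k h => [|k IH] h hi.
  rewrite (row_sum_coord h); elim/big_ind: _ => [|f g|i _].
  - exact: Ck_cst.
  - exact: CkD.
  - by move=> x Ux; apply: cvgZ; [exact: hi|exact: cvg_cst].
have hd x : U x -> differentiable h x.
  move=> Ux; rewrite (row_sum_coord h); apply: differentiable_sum => i.
  by apply: differentiableZl; have [] := hi i => /(_ x Ux).
split=> // v; apply: IH => i.
have [_ /(_ v)] := hi i.
by apply: Ck_eq => // x Ux; rewrite diff_coord //; exact: hd.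
Qed.

End OpenScalar.

(** By the chain rule the differential of the composite is a sum of products of
    directional derivatives of g along the basis, composed with h, and of
    coordinates of the differential of h; both are one order less regular. *)
Lemma Ck_comp V n k (U : set V) (U' : set 'rV[R]_n) (g : 'rV[R]_n -> R^o)
    (h : V -> 'rV[R]_n) : open U -> open U' -> (forall x, U x -> U' (h x)) ->
  Ck k U' g -> Ck k U h -> Ck k U (g \o h).
Proof.
move=> oU oU' hU; elim: k g h hU => [|k IH] g h hU.
  by move=> hg hh x Ux; apply: continuous_comp; [exact: hh|exact/hg/hU].
move=> [g1 g2] hh; have [h1 h2] := hh; split=> [x Ux|v].
  by apply: differentiable_comp; [exact: h1|exact/g1/hU].
apply: (@Ck_eq _ _ _ _ (\sum_(i < n) (fun x => 'd h x v 0 i *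
    ((fun y => 'd g y (delta_mx 0 i)) \o h) x : R^o))) => //.
  by move=> x Ux; rewrite fct_sumE diff_comp_row; [|exact: h1|exact/g1/hU].
elim/big_ind: _ => [|p q|i _]; [exact: Ck_cst|exact: CkD|].
apply: CkM => //; first exact: Ck_coord (h2 v).
exact: IH hU (g2 _) (CkS hh).
Qed.

End Ck_theory.

(** * Germs of smooth functions *)

Lemma is_derive_inv (R : realType) (t : R) :
  t != 0 -> is_derive t 1 (@GRing.inv R) (- t ^- 2).
Proof.
move=> t0; apply: DeriveDef; first by apply: derivableV.
by rewrite deriveV // derive_id /GRing.scale /= mulr1.
Qed.

Section Flat.
Variable R : realType.
Implicit Type p : {poly R}.

(** The function p(1/t) exp(-1/t), extended by zero: the derivatives of
    exp(-1/t) have this form, and the family is closed under derivation. *)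
Definition flat p (t : R) : R :=
  if 0 < t then p.[t^-1] * expR (- t^-1) else 0.

(** The exponential series dominates each monomial: s^i <= i! exp s for
    nonnegative s. *)
Lemma poly_expRN_bounded p : exists2 C, 0 < C &
  forall s : R, 0 < s -> `|p.[s] * expR (- s)| <= C.
Proof.
exists (1 + \sum_(i < size p) `|p`_i| * i`!%:R).
  by rewrite ltr_pwDl // sumr_ge0 // => i _; rewrite mulr_ge0.
move=> s s0; rewrite ler_wpDl // horner_coef mulr_suml.
apply: le_trans (ler_norm_sum _ _ _) _; apply: ler_sum => i _.
rewrite -mulrA normrM ler_wpM2l // ger0_norm; last first.
  by rewrite mulr_ge0 ?expR_ge0 // exprn_ge0 // ltW.
rewrite expRN ler_pdivrMr ?expR_gt0 // mulrC.
case: (nat_of_ord i) => [|j].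
  by rewrite expr0 fact0 mulr1 ltW // pexpR_gt1.
rewrite -ler_pdivrMr ?ltr0n ?fact_gt0 //.
have := expR_ge1Dxn j (ltW s0); apply: le_trans.
by rewrite lerDr.
Qed.

(** Apply the bound to X^2 p and to s = 1/t. *)
Lemma flat_le_sqr p : exists2 C, 0 < C & forall t, `|flat p t| <= C * t ^+ 2.
Proof.
have [C C0 hC] := poly_expRN_bounded (p * 'X^2).
exists C => // t; rewrite /flat; case: ifPn => t0; last first.
  by rewrite normr0 mulr_ge0 ?sqr_ge0 // ltW.
have := hC t^-1; rewrite invr_gt0 t0 => /(_ isT).
rewrite hornerM hornerXn mulrAC normrM (ger0_norm (sqr_ge0 _)).
by rewrite exprVn ler_pdivrMr // exprn_gt0.
Qed.

Lemma is_derive_flat p (t : R) :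
  is_derive t 1 (flat p) (flat ('X^2 * (p - p^`())) t).
Proof.
have [t0|t0|->] := ltgtP t 0.
- apply: (@near_eq_is_derive _ R^o R^o (cst 0)).
    near=> z; rewrite /flat ifN // -leNgt ltW //; near: z.
    by apply: lt_nbhsl.
  rewrite /flat ifN ?ltNge ?ltW //; exact: is_derive_cst.
- apply: (@near_eq_is_derive _ R^o R^o (fun z => p.[z^-1] * expR (- z^-1))).
    near=> z; rewrite /flat ifT //; near: z.
    by apply: lt_nbhsr.
  have dV := is_derive_inv (lt0r_neq0 t0).
  have dN : is_derive t 1 (fun z : R => - z^-1) (t ^- 2).
    by apply: is_derive_eq; rewrite opprK.
  have de := @is_derive1_comp R expR (fun z => - z^-1) t _ _ (is_derive_expR _) dN.
  have dp := @is_derive1_comp R (horner p) GRing.inv t _ _ (is_derive_poly p _) dV.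
  apply: (is_derive_eq (is_deriveM dp de)).
  rewrite /flat t0 /GRing.scale /= !hornerE !exprVn.
  change (p.[t^-1] * expR (- t^-1) * t ^- 2 +
          expR (- t^-1) * p^`().[t^-1] * (- t ^- 2) =
          t ^- 2 * (p.[t^-1] - p^`().[t^-1]) * expR (- t^-1)).
  ring.
- rewrite /flat ltxx.
  have [C C0 hC] := flat_le_sqr p.
  have h : (fun h : R => h^-1 *: (flat p (h *: (1:R) + 0) - flat p 0)) @ 0^'
      --> (0 : R).
    apply/cvgr0Pnorm_le => e e0.
    have e1 : 0 < e / C by rewrite divr_gt0.
    near=> h.
    have h0 : 0 < `|h| by rewrite normr_gt0; near: h; exact: nbhs_dnbhs_neq.
    have f0 : flat p 0 = 0 by rewrite /flat ltxx.
    rewrite f0 subr0 addr0 /GRing.scale /= mulr1 normrM normfV.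
    rewrite mulrC ler_pdivrMr //; apply: le_trans (hC h) _.
    rewrite -real_normK ?num_real // expr2 mulrA ler_pM2r //.
    rewrite mulrC -ler_pdivlMr //; near: h.
    exact: dnbhs0_le.
  apply: DeriveDef; first by apply/cvg_ex; exists 0.
  exact: cvg_lim h.
Unshelve. all: by end_near. Qed.

End Flat.

Section SmoothAt.
Variable R : realType.
Implicit Types V W : normedModType R.

(** Smoothness on some neighbourhood rather than at the sole point: iterated
    differentials at a point can only be computed from formulas that hold
    around it. *)
Definition smooth_at V W (g : V -> W) (y : V) : Prop :=
  exists2 U, open_nbhs y U & smooth_on U g.

Lemma smooth_onP V W (U : set V) (g : V -> W) : open U ->
  smooth_on U g <-> forall y, U y -> smooth_at g y.
Proof.
move=> oU; split=> [h y Uy|h k]; first by exists U.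
apply/Ck_ptP => y /h[U' [_ U'y] /(_ k)] /Ck_sub; apply.
by move=> _ ->.
Qed.

Lemma smooth_at_near V W (g : V -> W) y :
  smooth_at g y -> \forall z \near y, smooth_at g z.
Proof.
case=> U Uy /smooth_onP hU; apply: filterS (open_nbhs_nbhs Uy); apply: hU.
by case: Uy.
Qed.

Lemma near_smooth_at V W (f g : V -> W) y :
  (\forall z \near y, f z = g z) -> smooth_at f y -> smooth_at g y.
Proof.
move=> fg [U [oU Uy] fs]; pose U' := [set z | f z = g z]°.
have oU' : open U' by exact: open_interior.
exists (U `&` U'); first by split=> //; exact: openI.
move=> k; apply: (@Ck_eq _ _ _ k _ f); first exact: openI.
  by move=> z [_ /interior_subset].
by apply: Ck_sub (fs k) => z [].
Qed.

Lemma smooth_at_pair V W W' (f : V -> W) (g : V -> W') y :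
  smooth_at f y -> smooth_at g y ->
  exists U, [/\ open U, U y, smooth_on U f & smooth_on U g].
Proof.
move=> [U [oU Uy] fs] [U' [oU' U'y] gs]; exists (U `&` U'); split.
- exact: openI.
- by [].
- by move=> k; apply: Ck_sub (fs k) => z [].
- by move=> k; apply: Ck_sub (gs k) => z [].
Qed.

Lemma smooth_at_cst V W (b : W) y : smooth_at (fun _ : V => b) y.
Proof. by exists setT; [split=> //; exact: openT|move=> k; exact: Ck_cst]. Qed.

Lemma smooth_at_add V W (f g : V -> W) y :
  smooth_at f y -> smooth_at g y -> smooth_at (fun z => f z + g z) y.
Proof.
move=> fs gs; have [U [oU Uy hf hg]] := smooth_at_pair fs gs.
by exists U => // k; exact: CkD.
Qed.

Lemma smooth_at_mul V (f g : V -> R^o) y :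
  smooth_at f y -> smooth_at g y -> smooth_at (fun z => f z * g z : R^o) y.
Proof.
move=> fs gs; have [U [oU Uy hf hg]] := smooth_at_pair fs gs.
by exists U => // k; exact: CkM.
Qed.

Lemma smooth_at_opp V (f : V -> R^o) y :
  smooth_at f y -> smooth_at (fun z => - f z : R^o) y.
Proof.
move=> fs; apply: (@near_smooth_at _ _ (fun z => -1 * f z : R^o)).
  by near=> z; rewrite mulN1r.
by apply: smooth_at_mul => //; exact: smooth_at_cst.
Unshelve. all: by end_near. Qed.

Lemma smooth_at_sub V (f g : V -> R^o) y :
  smooth_at f y -> smooth_at g y -> smooth_at (fun z => f z - g z : R^o) y.
Proof. by move=> fs gs; apply: smooth_at_add => //; exact: smooth_at_opp. Qed.

Lemma smooth_at_sum V W (I : Type) (r : seq I) (f : I -> V -> W) y :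
  (forall i, smooth_at (f i) y) -> smooth_at (fun z => \sum_(i <- r) f i z) y.
Proof.
move=> fs; elim: r => [|i r IH].
  by under eq_fun do rewrite big_nil; exact: smooth_at_cst.
by under eq_fun do rewrite big_cons; exact: smooth_at_add.
Qed.

Lemma smooth_at_prod V (I : Type) (r : seq I) (f : I -> V -> R^o) y :
  (forall i, smooth_at (f i) y) ->
  smooth_at (fun z => \prod_(i <- r) f i z : R^o) y.
Proof.
move=> fs; elim: r => [|i r IH].
  by under eq_fun do rewrite big_nil; exact: smooth_at_cst.
by under eq_fun do rewrite big_cons; exact: smooth_at_mul.
Qed.

(** The germ version of [Ck_family]; it yields the exponential, the inverse and
    the flat functions below. *)
Lemma smooth_at_family V (F : set (R -> R)) (D : set R) (p : R -> R)
    (a : V -> R^o) y :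
  (forall p, F p -> exists2 p', F p' & forall t, D t -> is_derive t 1 p (p' t)) ->
  open D -> F p -> D (a y) -> smooth_at a y ->
  smooth_at (fun z => p (a z) : R^o) y.
Proof.
move=> FD oD Fp Dy [U [oU Uy] sa].
have ca : {for y, continuous a} by exact: (sa 0%N).
have nU : nbhs y (U `&` a @^-1` D).
  apply: filterI; first exact: open_nbhs_nbhs.
  by apply: ca; exact: open_nbhs_nbhs.
exists (U `&` a @^-1` D)°; first by split; [exact: open_interior|].
move=> k; apply: (Ck_family _ FD) => //; first exact: open_interior.
  by move=> x /interior_subset[].
by apply: Ck_sub (sa k) => x /interior_subset[].
Qed.

Lemma smooth_at_expR V (a : V -> R^o) y :
  smooth_at a y -> smooth_at (fun z => expR (a z) : R^o) y.
Proof.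
apply: (@smooth_at_family _ [set @expR R] setT) => //; last exact: openT.
by move=> _ ->; exists (@expR R) => // t _; exact: is_derive_expR.
Qed.

Lemma smooth_at_inv V (a : V -> R^o) y :
  a y != 0 -> smooth_at a y -> smooth_at (fun z => (a z)^-1 : R^o) y.
Proof.
move=> ay; apply: (@smooth_at_family _ (range (fun p t => p.[t^-1]))
  [set t | t != 0]) => //.
- move=> _ [p _ <-]; exists (fun t => (- 'X^2 * p^`()).[t^-1]).
    by exists (- 'X^2 * p^`()).
  move=> t /= t0.
  apply: (is_derive_eq (@is_derive1_comp R (horner p) GRing.inv t _ _
    (is_derive_poly p _) (is_derive_inv t0))).
  by rewrite !hornerE exprVn mulrC.
- by exists 'X => //; apply/funext => t; rewrite hornerX.
Qed.

Lemma smooth_at_flat V (p : {poly R}) (a : V -> R^o) y :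
  smooth_at a y -> smooth_at (fun z => flat p (a z) : R^o) y.
Proof.
apply: (@smooth_at_family _ (range (@flat R)) setT) => //; last exact: openT.
move=> _ [q _ <-]; exists (flat ('X^2 * (q - q^`()))) => [|t _].
  by eexists.
exact: is_derive_flat.
Qed.

Lemma smooth_at_coord V n (h : V -> 'rV[R]_n) i y :
  smooth_at h y -> smooth_at (fun x => h x 0 i : R^o) y.
Proof. by case=> U Uy sh; exists U => // k; case: Uy => ? _; exact: Ck_coord. Qed.

Lemma smooth_at_coords V n (h : V -> 'rV[R]_n) y :
  (forall i, smooth_at (fun x => h x 0 i : R^o) y) -> smooth_at h y.
Proof.
move=> hi; pose S := [set z | forall i, smooth_at (fun x => h x 0 i : R^o) z].
have nS : nbhs y S by apply: filter_forall => i; exact: smooth_at_near.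
exists S°; first by split; [exact: open_interior|].
move=> k; apply: Ck_coords => [|i]; first exact: open_interior.
apply: (proj2 (smooth_onP _ _)); first exact: open_interior.
by move=> z /interior_subset; exact.
Qed.

Lemma smooth_at_id n (y : 'rV[R]_n) : smooth_at id y.
Proof.
exists setT; first by split=> //; exact: openT.
case=> [|k] /=; first by move=> x _; exact: cvg_id.
split=> [x _|v]; first by have [] := is_diff_id x.
rewrite [X in Ck _ _ X](_ : _ = cst v); first exact: Ck_cst.
by apply/funext => x; have [_ ->] := is_diff_id x.
Qed.

Lemma smooth_at_comp V n (g : 'rV[R]_n -> R^o) (h : V -> 'rV[R]_n) y :
  smooth_at h y -> smooth_at g (h y) -> smooth_at (g \o h) y.
Proof.
move=> [U [oU Uy] sh] [D [oD Dy] sg].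
have ch : {for y, continuous h} by exact: (sh 0%N).
have nU : nbhs y (U `&` h @^-1` D).
  apply: filterI; first exact: open_nbhs_nbhs.
  by apply: ch; exact: open_nbhs_nbhs.
exists (U `&` h @^-1` D)°; first by split; [exact: open_interior|].
move=> k; apply: (Ck_comp (U' := D)) => //; first exact: open_interior.
  by move=> x /interior_subset[].
by apply: Ck_sub (sh k) => x /interior_subset[].
Qed.

Lemma smooth_at_differentiable V W (g : V -> W) y :
  smooth_at g y -> differentiable g y.
Proof. by case=> U [_ Uy] /(_ 1%N)[+ _]; exact. Qed.

Lemma smooth_at_continuous V W (g : V -> W) y :
  smooth_at g y -> {for y, continuous g}.
Proof. by case=> U [_ Uy] /(_ 0%N); exact. Qed.

Lemma smooth_at_diff V W (g : V -> W) y v :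
  smooth_at g y -> smooth_at (fun x => 'd g x v) y.
Proof. by case=> U Uy sg; exists U => // k; have [_] := sg k.+1; exact. Qed.

End SmoothAt.

(** * Bump functions *)

Section Bump.
Variable R : realType.

(** For positive e, a smooth step from 1, below e/2, to 0, beyond e; one of
    the two terms of the denominator is always positive. *)
Definition plateau (e q : R) : R :=
  flat 1 (e - q) / (flat 1 (e - q) + flat 1 (q - e / 2)).

Lemma flat1_gt0 (t : R) : 0 < t -> 0 < flat 1 t.
Proof. by move=> t0; rewrite /flat t0 hornerC mul1r expR_gt0. Qed.

Lemma flat_le0 (p : {poly R}) (t : R) : t <= 0 -> flat p t = 0.
Proof. by move=> t0; rewrite /flat ltNge t0. Qed.

Lemma flat1_ge0 (t : R) : 0 <= flat 1 t.
Proof. by have [/flat_le0 ->|/flat1_gt0/ltW] := leP t 0. Qed.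

Lemma plateau_eq1 e q : 0 < e -> q <= e / 2 -> plateau e q = 1.
Proof.
move=> e0 qe; rewrite /plateau (@flat_le0 _ (q - e / 2)) ?addr0 ?subr_le0 //.
by rewrite divff // gt_eqF // flat1_gt0; lra.
Qed.

Lemma plateau_eq0 e q : e <= q -> plateau e q = 0.
Proof. by move=> eq; rewrite /plateau flat_le0 ?mul0r // subr_le0. Qed.

Lemma smooth_at_plateau (V : normedModType R) (e : R) (q : V -> R^o) y :
  0 < e -> smooth_at q y -> smooth_at (fun z => plateau e (q z) : R^o) y.
Proof.
move=> e0 qs.
have s1 : smooth_at (fun z => flat 1 (e - q z) : R^o) y.
  by apply: smooth_at_flat; apply: smooth_at_sub => //; exact: smooth_at_cst.
have s2 : smooth_at (fun z => flat 1 (q z - e / 2) : R^o) y.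
  by apply: smooth_at_flat; apply: smooth_at_sub => //; exact: smooth_at_cst.
apply: smooth_at_mul => //; apply: smooth_at_inv; last exact: smooth_at_add.
have [qe|eq] := ltP (q y) e.
  by rewrite gt_eqF // ltr_pwDl ?flat1_ge0 // flat1_gt0 // subr_gt0.
by rewrite gt_eqF // ltr_wpDl ?flat1_ge0 // flat1_gt0 //; lra.
Qed.

(** A product of one-variable plateaus of the squared coordinates; it vanishes
    outside a cube, which is compact. *)
Lemma exists_bump n (y : 'rV[R]_n) (U : set 'rV[R]_n) : nbhs y U ->
  exists (b : 'rV[R]_n -> R^o) (K : set 'rV[R]_n),
    [/\ forall z, smooth_at b z, \forall z \near y, b z = 1, compact K,
       K `<=` U & forall z, ~ K z -> b z = 0].
Proof.
move=> /nbhs_ballP[e /= e0 eU]; pose r := e / 2.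
have r0 : 0 < r by rewrite divr_gt0.
exists (fun z => \prod_(i < n) plateau (r ^+ 2) ((z 0 i - y 0 i) ^+ 2)).
exists [set z : 'rV[R]_n | forall i, z 0 i \in `[y 0 i - r, y 0 i + r]]; split.
- move=> z; apply: smooth_at_prod => i.
  apply: smooth_at_plateau; first by rewrite exprn_gt0.
  have s : smooth_at (fun z : 'rV[R]_n => z 0 i - y 0 i : R^o) z.
    apply: smooth_at_sub; last exact: smooth_at_cst.
    exact/smooth_at_coord/smooth_at_id.
  exact: smooth_at_mul.
- have r20 : 0 < r / 2 by rewrite divr_gt0.
  apply: filterS (nbhsx_ballx y _ r20) => z yz.
  apply: big1 => i _; apply: plateau_eq1; first by rewrite exprn_gt0.
  have [_ /(_ 0 i)] := yz; rewrite /ball /= distrC => zy.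
  move: zy; rewrite ltr_norml => /andP[]; rewrite !expr2; nra.
- apply: (rV_compact (A := fun i => `[y 0 i - r, y 0 i + r]%classic)) => i.
  exact: segment_compact.
- move=> z zK; apply: eU; split=> // j i; rewrite ord1 /ball /=.
  have := zK i; rewrite /= in_itv /= => /andP[h1 h2].
  rewrite ltr_norml /r in h1 h2 *; lra.
- move=> z /existsNP[i zi]; rewrite (bigD1 i) //= plateau_eq0 ?mul0r //.
  rewrite -[leRHS]real_normK ?num_real // ler_sqr ?nnegrE ?(ltW r0) //.
  rewrite leNgt; apply/negP => h; apply: zi; rewrite /= in_itv /=.
  move: h; rewrite ltr_norml => /andP[h1 h2]; apply/andP; split; lra.
Qed.
End Bump.

(** * Covers, matrices and charts *)

(** Each basic open set contained in some F p chooses one such p. *)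
Lemma lindelof (T : topologicalType) (x0 : T) (F : T -> set T) :
  @second_countable T -> (forall x, nbhs x (F x)) ->
  exists s : nat -> T, forall x, exists k, F (s k) x.
Proof.
move=> [B /countable_injP[f finj] [_ Bb]] nF.
pose P k := [set p | exists U, [/\ B U, f U = k & U `<=` F p]].
exists (fun k => xget x0 (P k)) => x.
have [U /= [BU Ux] UF] := Bb x _ (nF x).
have : P (f U) x by exists U.
move=> /(xgetI x0)[U' [BU' fU' U'F]]; exists (f U).
by apply: U'F; rewrite (finj U' U) ?inE.
Qed.

Section SmoothMatrix.
Variables (R : realType) (V : normedModType R).

Lemma smooth_at_det m (A : V -> 'M[R]_m) y :
  (forall i j, smooth_at (fun z => A z i j : R^o) y) ->
  smooth_at (fun z => \det (A z) : R^o) y.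
Proof.
move=> As; apply: smooth_at_sum => s; apply: smooth_at_mul.
  exact: smooth_at_cst.
exact: smooth_at_prod.
Qed.

Lemma near_unitmx m (A : V -> 'M[R]_m) y :
  (forall i j, smooth_at (fun z => A z i j : R^o) y) -> A y \in unitmx ->
  \forall z \near y, A z \in unitmx.
Proof.
move=> As; rewrite unitmxE unitfE => d0.
have c := smooth_at_continuous (smooth_at_det As).
have : nbhs (\det (A y)) [set t : R | t != 0].
  by apply: open_nbhs_nbhs; split=> //; exact: open_neq.
move/c => nP; have nP' : nbhs y [set z | \det (A z) != 0] by exact: nP.
by apply: filterS nP' => z; rewrite /= unitmxE unitfE.
Qed.

(** Cramer's rule: near y the inverse is the adjugate divided by the
    determinant. *)
Lemma smooth_at_invmx m (A : V -> 'M[R]_m) y i j :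
  (forall i j, smooth_at (fun z => A z i j : R^o) y) -> A y \in unitmx ->
  smooth_at (fun z => invmx (A z) i j : R^o) y.
Proof.
move=> As Ay.
apply: (@near_smooth_at _ _ _ (fun z => (\det (A z))^-1 * cofactor (A z) j i)).
  by apply: filterS (near_unitmx As Ay) => z Az; rewrite /invmx Az !mxE.
apply: smooth_at_mul.
  by apply: smooth_at_inv; [rewrite -unitfE -unitmxE|exact: smooth_at_det].
apply: smooth_at_mul; first exact: smooth_at_cst.
apply: smooth_at_det => k l.
by under eq_fun do rewrite !mxE.
Qed.

End SmoothMatrix.

Section Charts.
Variables (R : realType) (n : nat) (M : manifold R n).
Implicit Types (c d : chart R n M) (x : M).

(** Transports a neighbourhood in M to one in the codomain of the chart, where
    the two maps of the chart are moreover inverse to each other. *)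
Lemma near_chart_inv c x (P : set M) : dom c x -> nbhs x P ->
  \forall y \near c x, [/\ dom c (chart_inv c y), c (chart_inv c y) = y
                         & P (chart_inv c y)].
Proof.
move=> cx nP.
have cod : (c @` dom c) (c x) by exists x.
have n1 : nbhs (c x) (c @` dom c).
  by apply: open_nbhs_nbhs; split=> //; exact: open_codom.
have n2 : nbhs (c x) (chart_inv c @^-1` P).
  by apply: (chart_inv_continuous cod); rewrite chart_funK.
apply: filterS2 n1 n2 => y [z cz <-] /=.
by rewrite chart_funK.
Qed.

Lemma near_dom c x : dom c x -> \forall z \near x, dom c z.
Proof. by move=> cx; apply: open_nbhs_nbhs; split=> //; exact: open_dom. Qed.

Lemma open_chart_image c (A : set M) : open A -> open (c @` (dom c `&` A)).
Proof.
move=> oA; rewrite openE => _ [x [cx Ax] <-].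
have nA : nbhs x A by exact: open_nbhs_nbhs.
apply: filterS (near_chart_inv cx nA) => y [cy ey Ay].
by exists (chart_inv c y).
Qed.

Lemma smooth_transition c d x : atlas c -> atlas d -> dom c x -> dom d x ->
  smooth_at (d \o chart_inv c) (c x).
Proof.
move=> ac ad cx dx; have := atlas_compatible ac ad.
move/smooth_onP; apply; last by exists x.
by apply: open_chart_image; exact: open_dom.
Qed.

Lemma near_transition (W : Type) (g : M -> W) c d x :
  dom c x -> dom d x ->
  \forall y \near c x,
    ((g \o chart_inv d) \o (d \o chart_inv c)) y = (g \o chart_inv c) y.
Proof.
move=> cx dx; apply: filterS (near_chart_inv cx (near_dom dx)) => y [_ _ dy].
by rewrite /= chart_funK.
Qed.

(** The chain rule for the change of charts from c to d.  With g a scalar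
    function it says that its differential does not depend on the chart; with
    g a chart it is the cocycle relation of the transition maps. *)
Lemma diff_transition (W : normedModType R) (g : M -> W) c d x v :
  atlas c -> atlas d -> dom c x -> dom d x ->
  differentiable (g \o chart_inv d) (d x) ->
  'd (g \o chart_inv d) (d x) ('d (d \o chart_inv c) (c x) v) =
  'd (g \o chart_inv c) (c x) v.
Proof.
move=> ac ad cx dx dg.
have E : (d \o chart_inv c) (c x) = d x by rewrite /= chart_funK.
have ds : differentiable (d \o chart_inv c) (c x).
  exact/smooth_at_differentiable/smooth_transition.
have dg' : differentiable (g \o chart_inv d) ((d \o chart_inv c) (c x)).
  by rewrite E.
have dgc := differentiable_comp ds dg'.
have [_ dE] := @near_eq_is_diff _ _ _ ((g \o chart_inv d) \o (d \o chart_inv c))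
  (g \o chart_inv c) (c x) (near_transition g cx dx) dgc.
have dC := diff_comp ds dg'; rewrite E in dC.
apply/esym; apply: (etrans (congr1 (@^~ v) dE)).
exact: (congr1 (@^~ v) dC).
Qed.

Lemma chart_at_atlas x : atlas (chart_at x).
Proof. by rewrite /chart_at; case: cid2. Qed.

Lemma chart_at_dom x : dom (chart_at x) x.
Proof. by rewrite /chart_at; case: cid2. Qed.

Lemma diff_chart_id c x v : dom c x -> 'd (c \o chart_inv c) (c x) v = v.
Proof.
move=> cx.
have e : \forall y \near c x, id y = (c \o chart_inv c) y.
  by apply: filterS (near_chart_inv cx (near_dom cx)) => y [_ /= -> _].
have [di dE] := is_diff_id (c x).
by have [_ ->] := near_eq_is_diff e di; rewrite dE.
Qed.

Lemma components_coord_vector c d x e : atlas c -> atlas d -> dom c x -> dom d x ->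
  components d (coord_vector c x e) = 'd (d \o chart_inv c) (c x) e.
Proof.
move=> ac ad cx dx; have ak := chart_at_atlas x; have kx := chart_at_dom x.
apply: diff_transition => //.
exact/smooth_at_differentiable/smooth_transition.
Qed.

Lemma coord_vector_chart_at x e : coord_vector (chart_at x) x e = e.
Proof. exact/diff_chart_id/chart_at_dom. Qed.

Definition smooth_fun_at (f : M -> R) x := forall c, atlas c -> dom c x ->
  smooth_at (f \o chart_inv c : _ -> R^o) (c x).

Definition smooth_vfield_at (X : vfield M) x := forall c, atlas c -> dom c x ->
  smooth_at (fun y => components c (X (chart_inv c y))) (c x).

Lemma smooth_vfieldP (X : vfield M) :
  smooth_vfield X <-> forall x, smooth_vfield_at X x.
Proof.
split=> [sX x c ac cx|sX c ac].
  have /smooth_onP := sX c ac; apply; last by exists x.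
  exact: open_codom.
apply/smooth_onP; first exact: open_codom.
by move=> _ [x cx <-]; exact: sX.
Qed.

Lemma near_smooth_fun_at (f g : M -> R) x :
  (\forall z \near x, f z = g z) -> smooth_fun_at f x -> smooth_fun_at g x.
Proof.
move=> fg sf c ac cx; apply: near_smooth_at (sf c ac cx).
by apply: filterS (near_chart_inv cx fg) => y [].
Qed.

Lemma near_smooth_vfield_at (X Y : vfield M) x :
  (\forall z \near x, X z = Y z) -> smooth_vfield_at X x -> smooth_vfield_at Y x.
Proof.
move=> XY sX c ac cx; apply: near_smooth_at (sX c ac cx).
by apply: filterS (near_chart_inv cx XY) => y [_ _ ->].
Qed.

(** Smoothness may be tested in a single chart, because the transition maps are
    smooth. *)
Lemma smooth_fun_at_chart (f : M -> R) c x : atlas c -> dom c x ->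
  smooth_at (f \o chart_inv c : _ -> R^o) (c x) -> smooth_fun_at f x.
Proof.
move=> ac cx sf d ad dx; apply: near_smooth_at (near_transition f dx cx) _.
apply: smooth_at_comp; first exact: smooth_transition.
by rewrite /= chart_funK.
Qed.

(** In another chart the components are obtained by applying to [a] the
    differential of the transition map, whose matrix is smooth. *)
Lemma smooth_vfield_at_chart (X : vfield M) c x (a : 'rV[R]_n -> 'rV[R]_n) :
  atlas c -> dom c x -> smooth_at a (c x) ->
  (\forall z \near x, X z = coord_vector c z (a (c z))) -> smooth_vfield_at X x.
Proof.
move=> ac cx sa eX d ad dx.
have n1 : \forall z \near x, [/\ X z = coord_vector c z (a (c z)), dom c z & dom d z].
  have nc := near_dom cx; have nd := near_dom dx.
  by near=> z; split; near: z.
pose g y := 'd (d \o chart_inv c) y (a y).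
apply: (@near_smooth_at _ _ _ (g \o (c \o chart_inv d))).
  apply: filterS (near_chart_inv dx n1) => y [_ ey [-> cy dy]].
  rewrite components_coord_vector //.
apply: smooth_at_coords => j.
apply: (@smooth_at_comp _ _ _ (fun y => g y 0 j : R^o)).
  exact: smooth_transition.
rewrite /= chart_funK //.
apply: (@near_smooth_at _ _ _
   (fun y => \sum_i a y 0 i * 'd (d \o chart_inv c) y (delta_mx 0 i) 0 j : R^o)).
  near=> y; rewrite /g [in RHS](row_sum_delta (a y)) linear_sum summxE.
  by apply: eq_bigr => i _; rewrite linearZ mxE.
apply: smooth_at_sum => i; apply: smooth_at_mul; first exact: smooth_at_coord.
apply: smooth_at_coord; apply: smooth_at_diff; exact: smooth_transition.
Unshelve. all: by end_near. Qed.

Lemma smooth_vfield_at_add (X Y : vfield M) x :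
  smooth_vfield_at X x -> smooth_vfield_at Y x ->
  smooth_vfield_at (fun z => X z + Y z) x.
Proof.
move=> sX sY c ac cx.
apply: near_smooth_at (smooth_at_add (sX c ac cx) (sY c ac cx)).
by near=> y; rewrite /components linearD.
Unshelve. all: by end_near. Qed.

Lemma smooth_vfield_at_scale (g : M -> R) (X : vfield M) x :
  smooth_fun_at g x -> smooth_vfield_at X x ->
  smooth_vfield_at (fun z => g z *: X z) x.
Proof.
move=> sg sX c ac cx; apply: smooth_at_coords => j.
apply: near_smooth_at (smooth_at_mul (sg c ac cx)
  (smooth_at_coord j (sX c ac cx))).
by near=> y; rewrite /components linearZ mxE.
Unshelve. all: by end_near. Qed.

Lemma smooth_vfield_at0 x : smooth_vfield_at (fun=> 0) x.
Proof.
move=> c ac cx; apply: near_smooth_at (smooth_at_cst 0 _).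
by near=> y; rewrite /components linear0.
Unshelve. all: by end_near. Qed.

(** A bump function of the chart, extended by zero.  Its support is the image of
    a compact set, hence closed as M is Hausdorff, so that the extension
    vanishes near every point outside it. *)
Lemma exists_smooth_cutoff x (O : set M) : nbhs x O ->
  exists G : M -> R, [/\ forall z, smooth_fun_at G z,
    \forall z \near x, G z = 1 &
    forall z : M, nbhs z O \/ \forall t \near z, G t = 0].
Proof.
move=> nO; set c := chart_at x.
have ac : atlas c by exact: chart_at_atlas.
have cx : dom c x by exact: chart_at_dom.
have nO' : nbhs x O° by exact: nbhs_interior.
have [b [K [sb b1 cK KU b0]]] := exists_bump (near_chart_inv cx nO').
pose G z : R := if `[< dom c z >] then b (c z) else 0.
pose KM := chart_inv c @` K.
have KMdom z : KM z -> dom c z /\ O° z by move=> [y /KU[? _ ?] <-].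
have clKM : closed KM.
  apply: compact_closed; first exact: manifold_hausdorff.
  apply: continuous_compact => //; apply: continuous_in_subspaceT => y.
  rewrite inE => /KU[cy ey _]; apply: chart_inv_continuous.
  by exists (chart_inv c y).
have G0 z : ~ KM z -> G z = 0.
  rewrite /G; case: asboolP => // cz nK; apply: b0 => Kz; apply: nK.
  by exists (c z) => //; rewrite chart_funK.
have nG0 z : ~ KM z -> \forall t \near z, G t = 0.
  move=> nK; have : nbhs z (~` KM).
    by apply: open_nbhs_nbhs; split=> //; exact: closed_openC.
  by apply: filterS => t; exact: G0.
have Gb z : dom c z -> G z = b (c z) by move=> cz; rewrite /G asboolT.
exists G; split.
- move=> z; have [/KMdom[cz _]|/nG0 nz] := pselect (KM z).
    apply: (smooth_fun_at_chart ac cz); apply: near_smooth_at (sb (c z)).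
    by apply: filterS (near_chart_inv cz (near_dom cz)) => y [cy ey _]; rewrite /= Gb ?ey.
  apply: (@near_smooth_fun_at (fun=> 0)); first by apply: filterS nz => t ->.
  by move=> d ad dz; exact: smooth_at_cst.
- have nb : \forall z \near x, b (c z) = 1 by exact: (chart_continuous cx) b1.
  by apply: filterS2 nb (near_dom cx) => z bz cz; rewrite Gb.
- move=> z; have [/KMdom[_ Oz]|/nG0 nz] := pselect (KM z); last by right.
  by left; exact: Oz.
Qed.

End Charts.

(** * Liouville vector fields *)

Section Liouville.
Variables (R : realType) (n : nat) (M : manifold R n).
Variables (tau : covfield M) (omega : bilfield M).
Hypotheses (form1 : is_form1 tau) (form2 : is_form2 omega).
Variable k : nat.
Hypothesis rank_omega : forall x : M,
  (\dim {:tangent x} - \dim (lker (omega x)) = k)%N.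
Hypothesis ker_le : forall x : M, (lker (omega x) <= lker (tau x))%VS.

Let alt (x : M) : alternating_form (omega x) := form2.1 x.

Lemma smooth_at_form1 (c : chart R n M) x e : atlas c -> dom c x ->
  smooth_at (fun y => tau (chart_inv c y) (coord_vector c (chart_inv c y) e) : R^o)
    (c x).
Proof.
move=> ac cx; have /smooth_onP := form1 ac e; apply; last by exists x.
exact: open_codom.
Qed.

Lemma smooth_at_form2 (c : chart R n M) x e e' : atlas c -> dom c x ->
  smooth_at (fun y => omega (chart_inv c y) (coord_vector c (chart_inv c y) e)
    (coord_vector c (chart_inv c y) e') : R^o) (c x).
Proof.
move=> ac cx; have /smooth_onP := form2.2 c ac e e'; apply; last by exists x.
exact: open_codom.
Qed.

(** In the chart at p, start from the constant field with value v and correct it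
    by a combination of fixed vectors [u i] that span a complement of the
    kernel at p.  The coefficients [l] are those that give the right pairings
    with the [u i]; they vanish at p.  Since the rank is constant, the [u i]
    still span a complement of the kernel at nearby points, where these
    pairings therefore suffice. *)
Lemma local_liouville (p : M) (v : tangent p) : omega p v = tau p ->
  exists X : vfield M, X p = v /\
    \forall x \near p, smooth_vfield_at X x /\ omega x (X x) = tau x.
Proof.
move=> wv; set c := chart_at p.
have ac : atlas c by exact: chart_at_atlas.
have cp : dom c p by exact: chart_at_dom.
have [m [u [dimm Gu]]] := exists_gram_unit (alt (x := p)).
pose U x i : tangent x := coord_vector c x (u i).
pose G y := gram (omega (chart_inv c y)) (U (chart_inv c y)).
pose t y : 'rV[R]_m := \row_j (tau (chart_inv c y) (U (chart_inv c y) j) -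
  omega (chart_inv c y) (coord_vector c (chart_inv c y) v) (U (chart_inv c y) j)).
pose l y := t y *m invmx (G y).
pose a y : 'rV[R]_n := v + \sum_i l y 0 i *: u i.
exists (fun x => coord_vector c x (a (c x))).
have Up : U p = u by apply/funext => i; exact: coord_vector_chart_at.
have Gs x i j : dom c x -> smooth_at (fun y => G y i j : R^o) (c x).
  move=> cx; under eq_fun do rewrite mxE; exact: smooth_at_form2.
have Gp : G (c p) \in unitmx by rewrite /G chart_funK // Up.
split.
  rewrite coord_vector_chart_at /a /l.
  have -> : t (c p) = 0.
    apply/rowP => j; rewrite !mxE chart_funK // coord_vector_chart_at wv.
    by rewrite subrr.
  by rewrite mul0mx big1 ?addr0 // => i _; rewrite mxE scale0r.
have nG := near_unitmx (fun i j => Gs p i j cp) Gp.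
have nG' : \forall x \near p, G (c x) \in unitmx by exact: (chart_continuous cp) nG.
apply: filterS2 nG' (near_dom cp) => x Gx cx; split.
  apply: (smooth_vfield_at_chart (c := c) (a := a) ac cx); last by near=> z.
  apply: smooth_at_add; first exact: smooth_at_cst.
  apply: smooth_at_sum => i; apply: smooth_at_coords => j.
  under eq_fun do rewrite mxE.
  apply: smooth_at_mul; last exact: smooth_at_cst.
  under eq_fun do rewrite mxE.
  apply: smooth_at_sum => q; apply: smooth_at_mul.
    under eq_fun do rewrite mxE.
    by apply: smooth_at_sub; [exact: smooth_at_form1|exact: smooth_at_form2].
  by apply: smooth_at_invmx => // i' j'; exact: Gs.
apply/subr0_eq; apply: (gram_separates (alt (x := x)) (u := U x)).
- have arith (i j N : nat) : (m + i = N -> i <= N -> j <= N ->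
    N - i = k -> N - j = k -> m + j = N)%N by lia.
  apply: (arith _ _ _ dimm _ _ (rank_omega p) (rank_omega x));
    by rewrite dimvS ?subvf.
- by move: Gx; rewrite /G chart_funK.
- apply/subvP => z zK; rewrite memv_ker add_lfunE opp_lfunE.
  have /eqP-> : tau x z == 0 by rewrite -memv_ker (subvP (ker_le x)).
  move: zK; rewrite memv_ker => /eqP zK.
  by rewrite (alternatingC (alt (x := x))) zK zero_lfunE !oppr0 addr0.
- move=> j; rewrite add_lfunE opp_lfunE /a /coord_vector linearD linear_sum.
  rewrite linearD add_lfunE.
  have -> : \sum_i 'd (chart_at x \o chart_inv c) (c x) (l (c x) 0 i *: u i) =
            \sum_i (t (c x) *m invmx (gram (omega x) (U x))) 0 i *: U x i.
    by apply: eq_bigr => i _; rewrite linearZ /l /G chart_funK.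
  rewrite gram_solve; last by move: Gx; rewrite /G chart_funK.
  rewrite mxE chart_funK // /coord_vector /= [X in X - _]addrC subrK.
  exact: subrr.
Unshelve. all: by end_near. Qed.

(** The product of a local solution with a cutoff function is a global field,
    which solves the equation up to the cutoff factor. *)
Lemma cutoff_liouville (p : M) (v : tangent p) : omega p v = tau p ->
  exists (G : M -> R) (Y : vfield M),
    [/\ forall x, smooth_fun_at G x, forall x, smooth_vfield_at Y x, Y p = v,
        \forall x \near p, G x = 1 & forall x, omega x (Y x) = G x *: tau x].
Proof.
move=> wv; have [X [Xp nX]] := local_liouville wv.
have [G [sG G1 G0]] := exists_smooth_cutoff nX.
exists G, (fun x => G x *: X x); split=> //.
- move=> x; have [nx|nx] := G0 x.
    by apply: smooth_vfield_at_scale => //; case: (nbhs_singleton nx).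
  apply: (@near_smooth_vfield_at _ _ _ (fun=> 0)); last exact: smooth_vfield_at0.
  by apply: filterS nx => z ->; rewrite scale0r.
- by rewrite (nbhs_singleton G1) scale1r.
- move=> x; rewrite linearZ /=; have [nx|nx] := G0 x.
    by case: (nbhs_singleton nx) => _ ->.
  by rewrite (nbhs_singleton nx) !scale0r.
Qed.

Section Gluing.
Variables (G : nat -> M -> R) (Y : nat -> vfield M).

(** The weight left by the first j cutoffs.  It vanishes as soon as one of them
    is 1, so the partial sums [glued] are stationary there. *)
Definition remainder j (x : M) : R := \prod_(i < j) (1 - G i x).

Definition glued j : vfield M := fun x => \sum_(i < j) remainder i x *: Y i x.

Lemma remainder_eq0 i j x : (i < j)%N -> G i x = 1 -> remainder j x = 0.
Proof.
by move=> ij Gi; rewrite /remainder (bigD1 (Ordinal ij)) //= Gi subrr mul0r.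
Qed.

Lemma gluedS j x : glued j.+1 x = glued j x + remainder j x *: Y j x.
Proof. exact: big_ord_recr. Qed.

Lemma gluedE i j x : (i < j)%N -> G i x = 1 -> glued j x = glued i.+1 x.
Proof.
move=> + Gi; elim: j => // j IH; rewrite ltnS leq_eqVlt => /orP[/eqP->//|ij].
by rewrite -(IH ij) gluedS (remainder_eq0 ij Gi) scale0r addr0.
Qed.

Lemma smooth_glued j x : (forall i, smooth_fun_at (G i) x) ->
  (forall i, smooth_vfield_at (Y i) x) -> smooth_vfield_at (glued j) x.
Proof.
move=> sG sY; elim: j => [|j IH].
  apply: (@near_smooth_vfield_at _ _ _ (fun=> 0)); last exact: smooth_vfield_at0.
  by near=> z; rewrite /glued big_ord0.
apply: (@near_smooth_vfield_at _ _ _ (fun z => glued j z + remainder j z *: Y j z)).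
  by near=> z; rewrite gluedS.
apply: smooth_vfield_at_add => //; apply: smooth_vfield_at_scale => // c ac cx.
apply: smooth_at_prod => i; apply: smooth_at_sub; first exact: smooth_at_cst.
exact: (sG i c ac cx).
Unshelve. all: by end_near. Qed.

(** The weights of the first j fields telescope: their sum is
    [1 - remainder j x]. *)
Lemma omega_glued j x : (forall i, omega x (Y i x) = G i x *: tau x) ->
  omega x (glued j x) = (1 - remainder j x) *: tau x.
Proof.
move=> wY; elim: j => [|j IH].
  by rewrite /glued /remainder !big_ord0 linear0 subrr scale0r.
rewrite gluedS linearD /= IH linearZ /= wY.
rewrite /remainder big_ord_recr /= scalerA -scalerDl; congr (_ *: _).
by rewrite mulrBr mulr1 opprB addrA [RHS]addrAC.
Qed.

End Gluing.

(** The field through v comes first in the sequence: its cutoff is 1 near p, so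
    the later ones do not affect the value there. *)
Lemma exists_liouville (p : M) (v : tangent p) : omega p v = tau p ->
  exists2 X : vfield M, liouville tau omega X & X p = v.
Proof.
move=> wv; have [G0 [Y0 [sG0 sY0 Y0p G0p wY0]]] := cutoff_liouville wv.
have /choice[D DP] : forall q : M, exists D : (M -> R) * vfield M,
    [/\ forall x, smooth_fun_at D.1 x, forall x, smooth_vfield_at D.2 x,
        \forall x \near q, D.1 x = 1 & forall x, omega x (D.2 x) = D.1 x *: tau x].
  move=> q; have [w /cutoff_liouville[G [Y [sG sY _ G1 wY]]]] :=
    alternating_image (alt (x := q)) (ker_le q).
  by exists (G, Y).
have [q|s hs] := lindelof p (F := fun q => [set x | (D q).1 x = 1]°)
    (manifold_second_countable M).
  by have [_ _ + _] := DP q; exact: nbhs_interior.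
pose G i := if i is j.+1 then (D (s j)).1 else G0.
pose Y i := if i is j.+1 then (D (s j)).2 else Y0.
have sG i x : smooth_fun_at (G i) x.
  by case: i => [|j] /=; [exact: sG0|have [] := DP (s j)].
have sY i x : smooth_vfield_at (Y i) x.
  by case: i => [|j] /=; [exact: sY0|have [] := DP (s j)].
have wY i x : omega x (Y i x) = G i x *: tau x.
  by case: i => [|j] /=; [exact: wY0|have [_ _ _] := DP (s j); exact].
have /choice[N NP] : forall x : M, exists i, \forall z \near x, G i z = 1.
  by move=> x; have [j xj] := hs x; exists j.+1.
(* Near x the partial sums are stationary after the index N x. *)
pose X : vfield M := fun x => glued G Y (N x).+1 x.
have XE i x : G i x = 1 -> X x = glued G Y i.+1 x.
  move=> Gi; have GN := nbhs_singleton (NP x).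
  rewrite /X -(gluedE _ (leq_maxl _ (i.+1)) GN).
  by rewrite (gluedE _ (leq_maxr _ _) Gi).
exists X; last first.
  rewrite (XE 0%N _ (nbhs_singleton G0p)).
  by rewrite /glued big_ord1 /remainder big_ord0 scale1r.
split; last first.
  move=> x; rewrite /X omega_glued; last by move=> i; exact: wY.
  by rewrite (remainder_eq0 _ (nbhs_singleton (NP x))) // subr0 scale1r.
apply/smooth_vfieldP => x.
apply: (@near_smooth_vfield_at _ _ _ (glued G Y (N x).+1)).
  by apply: filterS (NP x) => z Gz; rewrite (XE _ _ Gz).
by apply: smooth_glued.
Qed.

End Liouville.

(** * The rescaled pair *)

Section Conformal.
Variables (R : realType) (n : nat) (M : manifold R n).

(** Independence of the differential from the chart, which exhibits its
    components as smooth functions. *)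
Lemma df_coord_vector (f : M -> R) (c : chart R n M) (x : M) e :
  smooth_fun f -> atlas c -> dom c x ->
  df f x (coord_vector c x e) = 'd (f \o chart_inv c : _ -> R^o) (c x) e.
Proof.
move=> sf ac cx; have ak := chart_at_atlas x; have kx := chart_at_dom x.
rewrite /df lfunE; apply: diff_transition => //.
apply: smooth_at_differentiable; have /smooth_onP := sf _ ak; apply.
  exact: open_codom.
by exists x.
Qed.

Lemma smooth_fun_smooth_at (f : M -> R) (c : chart R n M) : smooth_fun f ->
  atlas c -> forall y, codom_chart c y -> smooth_at (f \o chart_inv c : _ -> R^o) y.
Proof. by move=> sf ac; apply: (smooth_onP _ _).1; [exact: open_codom|exact: sf]. Qed.

Lemma is_form1_scale (f : M -> R) (tau : covfield M) : smooth_fun f ->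
  is_form1 tau -> is_form1 (fun x => expR (f x) *: tau x).
Proof.
move=> sf st c ac e; apply/smooth_onP; first exact: open_codom.
move=> y cy; have sfy := smooth_fun_smooth_at sf ac cy.
apply: (@near_smooth_at _ _ _ (fun y => let x := chart_inv c y in
  expR (f x) * tau x (coord_vector c x e))).
  by near=> z; rewrite /= scale_lfunE.
apply: smooth_at_mul; first exact: smooth_at_expR.
by have /smooth_onP := st c ac e; apply => //; exact: open_codom.
Unshelve. all: by end_near. Qed.

Lemma is_form2_conformal (f : M -> R) (tau : covfield M) (omega : bilfield M) :
  smooth_fun f -> is_form1 tau -> is_form2 omega ->
  is_form2 (fun x => expR (f x) *: (wedge (df f x) (tau x) + omega x)).
Proof.
move=> sf st [alt sw]; split=> [x v|c ac e e'].
  by rewrite !scale_lfunE !add_lfunE wedgeE alt [X in X - _]mulrC subrr addr0 scaler0.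
have oc := @open_codom _ _ _ c.
apply/smooth_onP => // y cy; have sfy := smooth_fun_smooth_at sf ac cy.
have st' e1 : smooth_at (fun y => let x := chart_inv c y in
    tau x (coord_vector c x e1) : R^o) y.
  by have /smooth_onP := st c ac e1; apply.
have sw' : smooth_at (fun y => let x := chart_inv c y in
    omega x (coord_vector c x e) (coord_vector c x e') : R^o) y.
  by have /smooth_onP := sw c ac e e'; apply.
have sdf e1 : smooth_at (fun y => let x := chart_inv c y in
    df f x (coord_vector c x e1) : R^o) y.
  apply: near_smooth_at (smooth_at_diff e1 sfy).
  have : nbhs y (codom_chart c) by exact: open_nbhs_nbhs.
  apply: filterS => _ [x cx <-] /=.
  by rewrite chart_funK // df_coord_vector.
apply: (@near_smooth_at _ _ _ (fun y => let x := chart_inv c y in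
  expR (f x) * (df f x (coord_vector c x e) * tau x (coord_vector c x e') -
    tau x (coord_vector c x e) * df f x (coord_vector c x e') +
    omega x (coord_vector c x e) (coord_vector c x e')))).
  near=> z; rewrite /= !scale_lfunE !add_lfunE wedgeE; reflexivity.
apply: smooth_at_mul; first exact: smooth_at_expR.
apply: smooth_at_add => //.
by apply: smooth_at_sub; apply: smooth_at_mul.
Unshelve. all: by end_near. Qed.

End Conformal.

Unset Implicit Arguments.

Theorem proposition6p6 (R : realType) (n : nat) (M : manifold R n) (r : nat)
    (tau : covfield M) (omega : bilfield M) (f : M -> R)
    (htau_omega : doublet_of_class (2 * r + 2)%N tau omega)
    (htau : forall x : M, tau x <> 0)
    (hf : smooth_fun f) :
  doublet_of_class (2 * r + 1)%N
    (fun x => expR (f x) *: tau x)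
    (fun x => expR (f x) *: (wedge (df f x) (tau x) + omega x))
  <->
  (forall Delta : vfield M, liouville tau omega Delta ->
     forall x : M, lie_derivative Delta f x = -1).
Proof.
have [form1 form2 cls] := htau_omega.
have alt x : alternating_form (omega x) := form2.1 x.
have odd_iff x := odd_class_iff (df f x) (alt x) (htau x)
  (lt0r_neq0 (expR_gt0 (f x))) (cls x).
have ker_le x := even_class_lker (alt x) (cls x).
split=> [[_ _ cls'] X [_ wX] x|lieN1].
  exact: ((odd_iff x).1 (cls' x)).
split; [exact: is_form1_scale|exact: is_form2_conformal|move=> x].
apply: (proj2 (odd_iff x)) => v wv.
have rank_omega y : (\dim {:tangent y} - \dim (lker (omega y)) = 2 * r + 2)%N.
  by rewrite -(cls y) /class_at; congr (_ - \dim _)%N; apply/esym/capv_idPr.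
(* The hypothesis is about global fields: realize v as the value of one. *)
have [X lX <-] := exists_liouville form1 form2 rank_omega ker_le wv.
exact: lieN1.
Qed.
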